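(* Let $\mathbb{K}$ be a field, let $L=J(P)\subseteq 2^{[m]}$ be a natural distributive lattice, where $P$ is a poset on $[m]$, and let $G$ be the minimal graph of $P$. Then the lattice graphical model ideal equals the Hibi ideal: $I_{L,G}=I_L$ in $\mathbb{K}[p_S: S\in L]$.
   Context: Natural lattices: $L\subseteq 2^{[m]}$ is a distributive lattice if it is closed under $\cap$ and $\cup$. It is natural if $\emptyset\in L$, $[m]\in L$, and the rank of every $S\in L$ (the length of a maximal chain in $L$ from the minimum of $L$ to $S$) equals $\#S$. For a poset $P=([m],\le)$, $J(P)$ is the set of order ideals of $P$ (subsets $S\subseteq[m]$ such that $t\in S$, $s\le t$ imply $s\in S$). Every natural lattice is $J(P)$ for a poset $P$ on $[m]$. Minimal graph: the graph on $[m]$ underlying the Hasse diagram of $P$, i.e. whose edges are the pairs $\{i,j\}$ such that one of $i,j$ covers the other in $P$. Lattice graphical model ideal: let $G$ be a simple graph on $[m]$ containing the minimal graph. Let $\mathcal{C}(G)$ be the set of all cliques of $G$ (including $\emptyset$) and $\mathcal{C}(G)^{\max}$ the set of maximal cliques. Consider the $\mathbb{K}$-algebra homomorphisms from $\mathbb{K}[p_S:S\in L]$ given by $\phi_G: \ p_T\mapsto\prod_{S\in\mathcal{C}(G)^{\max}}a^S_{S\cap T}\in\mathbb{K}[a^S_U: S\in\mathcal{C}(G)^{\max},\,U\subseteq S]$ and $\psi_G:\ p_T\mapsto\prod_{S\in\mathcal{C}(G):\,S\subseteq T}c_S\in\mathbb{K}[c_S:S\in\mathcal{C}(G)]$ for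 $T\in L$. The lattice graphical model ideal is $I_{L,G}:=\ker\phi_G=\ker\psi_G$ (these kernels coincide). Hibi ideal: $I_L=\langle p_Sp_T-p_{S\cap T}\,p_{S\cup T}: S,T\in L\rangle\subseteq\mathbb{K}[p_S:S\in L]$. *)

(* Defs.v *)
From HB Require Import structures.
From mathcomp Require Import all_boot all_order all_algebra.
From mathcomp.multinomials Require Import mpoly.

Set Implicit Arguments.
Unset Strict Implicit.
Unset Printing Implicit Defensive.

Import GRing.Theory.

(* The ground set [m] is 'I_m; families of subsets of [m] are {set {set 'I_m}}. *)

Section Combinatorics.
Context (m : nat).
Implicit Types (L C : {set {set 'I_m}}) (S T A B : {set 'I_m}).
Implicit Types (le G : rel 'I_m).

Definition distributive_lattice L : Prop :=
  forall S T, S \in L -> T \in L -> (S :&: T \in L) /\ (S :|: T \in L).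

Definition chain C : bool :=
  [forall A in C, forall B in C, (A \subset B) || (B \subset A)].

(* C is a maximal chain in L from A to B, i.e. inclusion-maximal among the
   chains of the interval [A, B] of L; its length is #|C|.-1. *)
Definition max_chain L A B C : bool :=
  maxset (fun D : {set {set 'I_m}} =>
    (D \subset [set T in L | (A \subset T) && (T \subset B)]) && chain D) C.

Definition lattice_min L : {set 'I_m} := \bigcap_(S in L) S.

Definition natural_lattice L : Prop :=
  [/\ distributive_lattice L, set0 \in L, setT \in L
    & forall S, S \in L -> forall C, max_chain L (lattice_min L) S C ->
        #|C|.-1 = #|S|].

Definition partial_order le : Prop :=
  [/\ reflexive le, antisymmetric le & transitive le].

Definition order_ideals le : {set {set 'I_m}} :=
  [set S : {set 'I_m} | [forall t in S, forall s, le s t ==> (s \in S)]].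

Definition covers le (i j : 'I_m) : bool :=
  [&& i != j, le i j &
      [forall k, (le i k && le k j) ==> ((k == i) || (k == j))]].

Definition minimal_graph le : rel 'I_m :=
  fun i j => covers le i j || covers le j i.

Definition cliques G : {set {set 'I_m}} :=
  [set S : {set 'I_m} | [forall i in S, forall j in S, (i != j) ==> G i j]].

Definition max_cliques G : {set {set 'I_m}} :=
  [set S : {set 'I_m} | maxset (mem (cliques G)) S].

(* The pairs (S, U) indexing the unknowns a^S_U. *)
Definition a_index G : {set {set 'I_m} * {set 'I_m}} :=
  [set SU : {set 'I_m} * {set 'I_m} | (SU.1 \in max_cliques G) && (SU.2 \subset SU.1)].

End Combinatorics.

Section OrderIdeals.
Context (m : nat) (le : rel 'I_m) (le_po : partial_order le).

Lemma order_idealP (S : {set 'I_m}) :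
  reflect (forall t s, t \in S -> le s t -> s \in S) (S \in order_ideals le).
Proof.
rewrite inE; apply: (iffP forall_inP) => [H t s tS st|H t tS].
  by have /forallP/(_ s)/implyP/(_ st) := H t tS.
by apply/forallP => s; apply/implyP; apply: H.
Qed.

Lemma order_ideals_lattice : distributive_lattice (order_ideals le).
Proof.
move=> S T /order_idealP hS /order_idealP hT; split; apply/order_idealP => t s.
  by move=> /setIP[tS tT] st; rewrite inE (hS t s tS st) (hT t s tT st).
move=> /setUP[tS|tT] st; rewrite inE; apply/orP.
  by left; apply: hS tS st.
by right; apply: hT tT st.
Qed.

Lemma order_ideals_refine (A B : {set 'I_m}) :
  A \in order_ideals le -> B \in order_ideals le -> A \proper B ->
  exists D, [/\ D \in order_ideals le, A \subset D, D \subset B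
              & #|D| = #|A|.+1].
Proof.
have [le_refl le_anti le_trans] := le_po.
move=> /order_idealP hA /order_idealP hB /properP[AB [x0 x0B x0A]].
pose below x := [set y in B :\: A | le y x].
have xP : x0 \in B :\: A by rewrite inE x0A.
case: (arg_minnP (fun x => #|below x|) xP) => x /setDP[xB xA] mn.
exists (x |: A); split; first last.
- by rewrite cardsU1 xA.
- by rewrite subUset sub1set xB.
- exact: subsetUr.
apply/order_idealP => t s; rewrite !inE => /orP[/eqP->|tA] st; last first.
  by rewrite (hA t) ?orbT.
case sA: (s \in A); rewrite ?orbT // orbF; apply/negPn/negP => sx.
have sBA : s \in B :\: A by rewrite inE sA (hB x).
have := mn s sBA; rewrite leqNgt => /negP; apply; apply: proper_card.
apply/properP; split.
  apply/subsetP => y; rewrite !inE => /andP[-> ys] /=; exact: le_trans ys st.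
exists x; rewrite !inE xA xB //=; apply/negP => xs; case/eqP: sx.
by apply: le_anti; rewrite st.
Qed.

Lemma order_ideals_natural : natural_lattice (order_ideals le).
Proof.
have L0 : set0 \in order_ideals le.
  by apply/order_idealP => t s; rewrite inE.
split => //; [exact: order_ideals_lattice | |].
  by apply/order_idealP => t s _ _; apply: in_setT.
have -> : lattice_min (order_ideals le) = set0.
  by apply/eqP; rewrite -subset0; apply: bigcap_inf L0.
move=> S SL C /maxsetP[/andP[/subsetP CL /forall_inP chC] maxC].
have cmp A B : A \in C -> B \in C -> (A \subset B) || (B \subset A).
  by move=> AC BC; have /forall_inP := chC A AC; apply.
have addC (D : {set 'I_m}) : D \in order_ideals le -> D \subset S ->
    (forall A, A \in C -> (A \subset D) || (D \subset A)) -> D \in C.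
  move=> DL DS cD; rewrite -(maxC (D |: C)) ?setU11 ?subsetUr //.
  apply/andP; split.
    by apply/subsetP => A /setU1P[->|/CL //]; rewrite inE DL sub0set.
  apply/forall_inP => A AC; apply/forall_inP => B BC.
  case/setU1P: AC => [->|AC]; case/setU1P: BC => [->|BC]; rewrite ?subxx //.
  - by rewrite orbC; apply: cD.
  - exact: cD.
  - exact: cmp.
have CS A : A \in C -> A \subset S by move/CL; rewrite inE => /and3P[].
have COI A : A \in C -> A \in order_ideals le by move/CL; rewrite inE => /andP[].
have C0 : set0 \in C by apply: addC; rewrite ?sub0set // => A _; rewrite sub0set orbT.
have hit k : k <= #|S| -> exists2 A, A \in C & #|A| = k.
  elim: k => [|k IH] kS; first by exists set0; rewrite ?cards0.
  have [A AC Ak] := IH (ltnW kS).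
  have SC : S \in C by apply: addC => // B BC; rewrite CS.
  have SP : (S \in C) && (k < #|S|) by rewrite SC.
  case: (arg_minnP (fun B : {set 'I_m} => #|B|)
           (P := fun B => (B \in C) && (k < #|B|)) SP) => B /andP[BC kB] mn.
  have AB : A \proper B.
    rewrite properEcard Ak kB andbT; case/orP: (cmp A B AC BC) => // BA.
    by have := subset_leq_card BA; rewrite Ak leqNgt kB.
  have [D [DL AD DB Dk]] := order_ideals_refine (COI A AC) (COI B BC) AB.
  exists D; last by rewrite Dk Ak.
  apply: addC => // [|E EC]; first exact: subset_trans DB (CS B BC).
  case: (leqP #|E| k) => kE.
    apply/orP; left; apply: subset_trans AD.
    case/orP: (cmp E A EC AC) => // AE.
    by rewrite -(eqP (_ : A == E)) // eqEcard AE Ak.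
  apply/orP; right; apply: subset_trans DB _.
  case/orP: (cmp B E BC EC) => // EB.
  by rewrite -(eqP (_ : E == B)) // eqEcard EB mn // EC.
have uC : uniq [seq #|A| | A : {set 'I_m} <- enum C].
  rewrite map_inj_in_uniq ?enum_uniq // => A B; rewrite !mem_enum => AC BC e.
  apply/eqP; case/orP: (cmp A B AC BC) => h; first by rewrite eqEcard h e leqnn.
  by rewrite eq_sym eqEcard h -e leqnn.
have /perm_size : perm_eq [seq #|A| | A : {set 'I_m} <- enum C] (iota 0 #|S|.+1).
  apply: uniq_perm; rewrite ?iota_uniq // => k; rewrite mem_iota add0n ltnS /=.
  apply/mapP/idP => [[A AC ->]|kS].
    by apply/subset_leq_card/CS; rewrite -mem_enum.
  have [A AC Ak] := hit k kS; exists A => //; by rewrite mem_enum.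
by rewrite size_map size_iota -cardE => ->.
Qed.

End OrderIdeals.

Local Open Scope ring_scope.

(* K[x_i : i in A] for a finite set A of labels is {mpoly K[#|A|]}, where the
   j-th unknown 'X_j is labelled enum_val j.  [unknown K A i] is the unknown
   labelled i; it is 0 when i \notin A. *)
Definition unknown (K : fieldType) (I : finType) (A : {set I}) (i : I) :
    {mpoly K[#|A|]} :=
  if [pick j : 'I_#|A| | enum_val j == i] is Some j then 'X_j else 0.

(* The K-algebra homomorphism from K[x_i : i in A] sending x_i to h i. *)
Definition alg_hom (K : fieldType) (I : finType) (A : {set I}) (n : nat)
    (h : I -> {mpoly K[n]}) (f : {mpoly K[#|A|]}) : {mpoly K[n]} :=
  mmap (@mpolyC n K) (fun j : 'I_#|A| => h (enum_val j)) f.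

Definition generated_ideal (R : comNzRingType) (B : R -> Prop) (f : R) : Prop :=
  exists s : seq (R * R),
    (forall x, x \in s -> B x.2) /\ f = \sum_(x <- s) x.1 * x.2.

Section Ideals.
Context (K : fieldType) (m : nat).
Implicit Types (L : {set {set 'I_m}}) (G : rel 'I_m).

Definition phi_hom L G : {mpoly K[#|L|]} -> {mpoly K[#|a_index G|]} :=
  alg_hom (fun T : {set 'I_m} =>
    \prod_(S in max_cliques G) unknown K (a_index G) (S, S :&: T)).

Definition psi_hom L G : {mpoly K[#|L|]} -> {mpoly K[#|cliques G|]} :=
  alg_hom (fun T : {set 'I_m} =>
    \prod_(S in cliques G | S \subset T) unknown K (cliques G) S).

(* The kernel of phi_hom; it is also that of psi_hom, see ker_phi_psi. *)
Definition lattice_graphical_ideal L G (f : {mpoly K[#|L|]}) : Prop :=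
  phi_hom G f = 0.

Definition hibi_relation L (g : {mpoly K[#|L|]}) : Prop :=
  exists S T : {set 'I_m}, [/\ S \in L, T \in L &
    g = unknown K L S * unknown K L T
        - unknown K L (S :&: T) * unknown K L (S :|: T)].

Definition hibi_ideal L : {mpoly K[#|L|]} -> Prop :=
  generated_ideal (@hibi_relation L).

End Ideals.

Section Facts.

Lemma unknownE (K : fieldType) (I : finType) (A : {set I}) (j : 'I_#|A|) :
  unknown K A (enum_val j) = 'X_j.
Proof.
rewrite /unknown; case: pickP => [k /eqP/enum_val_inj-> //|/(_ j)].
by rewrite eqxx.
Qed.

Lemma mmap_unknown (K : fieldType) (S : comNzRingType) (g : {rmorphism K -> S})
    (I : finType) (A : {set I}) (h : I -> S) (i : I) :
  i \in A -> mmap g (fun j : 'I_#|A| => h (enum_val j)) (unknown K A i) = h i.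
Proof.
move=> iA; rewrite -(enum_rankK_in iA iA) unknownE mmapX mmap1U.
by rewrite (enum_rankK_in iA iA).
Qed.

Lemma rmorph_mmap (n : nat) (R : nzRingType) (S U : comNzRingType)
    (f : {rmorphism R -> S}) (h : 'I_n -> S) (g : {rmorphism S -> U})
    (p : {mpoly R[n]}) :
  g (mmap f h p) = mmap (g \o f) (g \o h) p.
Proof.
rewrite /mmap rmorph_sum; apply: eq_bigr => a _.
rewrite rmorphM /mmap1 rmorph_prod /=; congr (_ * _).
by apply: eq_bigr => i _; rewrite rmorphXn.
Qed.

Section Kernels.
Context (m : nat) (G : rel 'I_m).

Lemma cliques_sub (S T : {set 'I_m}) :
  S \in cliques G -> T \subset S -> T \in cliques G.
Proof.
rewrite !inE => /forall_inP cS /subsetP TS; apply/forall_inP => i /TS iS.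
apply/forall_inP => j /TS jS.
by move/forall_inP: (cS i iS) => /(_ j jS).
Qed.

Lemma max_cliquesW (S : {set 'I_m}) : S \in max_cliques G -> S \in cliques G.
Proof. by rewrite inE => /maxsetp. Qed.

Definition pick_max (S : {set 'I_m}) : {set 'I_m} :=
  odflt S [pick M in max_cliques G | S \subset M].

Lemma pick_maxP (S : {set 'I_m}) : S \in cliques G ->
  pick_max S \in max_cliques G /\ S \subset pick_max S.
Proof.
move=> cS; rewrite /pick_max; case: pickP => [M /andP[] //|noM].
have [M maxM SM] := maxset_exists (P := mem (cliques G)) cS.
by have := noM M; rewrite SM andbT inE maxM.
Qed.

Lemma pair_in (S T : {set 'I_m}) :
  S \in max_cliques G -> (S, S :&: T) \in a_index G.
Proof. by move=> SM; rewrite inE /= SM subsetIl. Qed.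

Lemma phi_unknown (K : fieldType) (L : {set {set 'I_m}}) (T : {set 'I_m}) :
  T \in L -> phi_hom G (unknown K L T) =
    \prod_(S in max_cliques G) unknown K (a_index G) (S, S :&: T).
Proof.
exact: (mmap_unknown (@mpolyC #|a_index G| K) (fun T : {set 'I_m} =>
  \prod_(S in max_cliques G) unknown K (a_index G) (S, S :&: T))).
Qed.

Lemma psi_unknown (K : fieldType) (L : {set {set 'I_m}}) (T : {set 'I_m}) :
  T \in L -> psi_hom G (unknown K L T) =
    \prod_(S in cliques G | S \subset T) unknown K (cliques G) S.
Proof.
exact: (mmap_unknown (@mpolyC #|cliques G| K) (fun T : {set 'I_m} =>
  \prod_(S in cliques G | S \subset T) unknown K (cliques G) S)).
Qed.

Lemma ker_phi_sub_psi (K : fieldType) (L : {set {set 'I_m}})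
    (f : {mpoly K[#|L|]}) : phi_hom G f = 0 -> psi_hom G f = 0.
Proof.
pose h (SU : {set 'I_m} * {set 'I_m}) : {mpoly K[#|cliques G|]} :=
  \prod_(C in cliques G | (C \subset SU.2) && (pick_max C == SU.1))
    unknown K (cliques G) C.
pose theta : {rmorphism {mpoly K[#|a_index G|]} -> {mpoly K[#|cliques G|]}} :=
  mmap (@mpolyC #|cliques G| K)
    (fun j : 'I_#|a_index G| => h (enum_val j)).
suff E : psi_hom G f = theta (phi_hom G f) by move=> f0; rewrite E f0 rmorph0.
rewrite /phi_hom /alg_hom rmorph_mmap /psi_hom /alg_hom.
apply: eq_bigr => a _; congr (_ * _); first by rewrite /= mmapC.
apply: mmap1_eq => i /=; set T := enum_val i.
rewrite -[mmap _ _]/(theta : _ -> _) rmorph_prod.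
rewrite (partition_big pick_max (mem (max_cliques G))) /=; last first.
  by move=> C /andP[/pick_maxP[]].
apply: eq_bigr => S SM; rewrite mmap_unknown ?pair_in //.
apply: eq_bigl => C /=; rewrite subsetI -andbA.
case: (boolP (C \in cliques G)) => //= /pick_maxP[_ Cs].
by case: eqP => [<-|]; rewrite ?Cs ?andbF.
Qed.

Lemma prod_interval_sign (F : fieldType) (x : F) (U V : {set 'I_m}) :
  x != 0 -> U \subset V ->
  \prod_(C : {set 'I_m} | (U \subset C) && (C \subset V))
    (if odd #|C :\: U| then x^-1 else x) = if U == V then x else 1.
Proof.
move=> x0 UV; have [->|neq] := eqVneq U V.
  rewrite (big_pred1 V) => [|C]; first by rewrite setDv cards0.
  by rewrite /= eqEsubset andbC.
have /properP[_ [v vV vU]] : U \proper V by rewrite properEneq neq.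
rewrite (bigID (fun C : {set 'I_m} => v \in C)) /=.
rewrite (reindex_onto (fun C : {set 'I_m} => v |: C) (fun C => C :\ v)) /=;
  last by move=> C /andP[_ vC]; rewrite setD1K.
rewrite (eq_bigl (fun C : {set 'I_m} =>
  ((U \subset C) && (C \subset V)) && (v \notin C))) => [|C].
  rewrite -big_split /= big1 // => C /andP[_ vC].
  rewrite setDUl (_ : [set v] :\: U = [set v]); last first.
    by apply/setDidPl; rewrite disjoints1.
  rewrite cardsU1 !inE (negbTE vC) andbF /=.
  by case: odd; rewrite /= ?mulfV ?mulVf.
rewrite subUset sub1set vV /= setU11 andbT.
have [vC|vC] := boolP (v \in C).
  rewrite !andbF; apply/negbTE/negP => /andP[_ /eqP E].
  by have := vC; rewrite -E !inE eqxx.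
rewrite setU1K // eqxx !andbT; congr (_ && _).
apply/idP/idP => [/subsetP H|]; last by move/subset_trans; apply; apply: subsetUr.
apply/subsetP => u uU; have := H u uU; rewrite !inE; case: eqP => // uv.
by rewrite -uv uU in vU.
Qed.

Lemma ker_psi_sub_phi (K : fieldType) (L : {set {set 'I_m}})
    (f : {mpoly K[#|L|]}) : psi_hom G f = 0 -> phi_hom G f = 0.
Proof.
pose Q := {fraction {mpoly K[#|a_index G|]}}.
pose x (S U : {set 'I_m}) : Q := tofrac (unknown K (a_index G) (S, U)).
have x0 (S U : {set 'I_m}) : S \in max_cliques G -> U \subset S -> x S U != 0.
  move=> SM US; have aI : (S, U) \in a_index G by rewrite inE /= SM.
  rewrite tofrac_eq0 -(enum_rankK_in aI aI) unknownE; apply/eqP => /(congr1 (mcoeff U_(enum_rank_in aI (S, U)))).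
  by rewrite mcoeffX eqxx mcoeff0 => /eqP; rewrite oner_eq0.
pose h (C : {set 'I_m}) : Q :=
  \prod_(S in max_cliques G | C \subset S)
    \prod_(U : {set 'I_m} | U \subset C)
      (if odd #|C :\: U| then (x S U)^-1 else x S U).
pose cst : {rmorphism K -> Q} := @tofrac _ \o @mpolyC #|a_index G| K.
pose theta : {rmorphism {mpoly K[#|cliques G|]} -> Q} :=
  mmap cst (fun j : 'I_#|cliques G| => h (enum_val j)).
suff E : tofrac (phi_hom G f) = theta (psi_hom G f).
  by move=> f0; apply/eqP; rewrite -tofrac_eq0 E f0 rmorph0.
rewrite /phi_hom /alg_hom rmorph_mmap /psi_hom /alg_hom rmorph_mmap.
apply: eq_bigr => a _; congr (_ * _); first by rewrite /= mmapC.
apply: mmap1_eq => i /=; set T := enum_val i.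
rewrite rmorph_prod -[mmap _ _]/(theta : _ -> _) rmorph_prod /=.
under [RHS]eq_bigr => C /andP[CG _].
  rewrite (mmap_unknown cst h CG) /h; over.
rewrite (exchange_big_dep (mem (max_cliques G))) /=; last by move=> C S _ /andP[].
apply: eq_bigr => S SM.
rewrite (exchange_big_dep (fun U : {set 'I_m} => U \subset S :&: T)) /=; last first.
  move=> C U /andP[/andP[_ CT] /andP[_ CS]] UC.
  by rewrite (subset_trans UC) // subsetI CS.
transitivity (\prod_(U : {set 'I_m} | U \subset S :&: T)
    (if U == S :&: T then x S U else 1)).
  rewrite (bigD1 (S :&: T)) //= eqxx big1 ?mulr1 // => U /andP[_ neq].
  by rewrite (negbTE neq).
apply: eq_bigr => U UST.
have US : U \subset S by apply: subset_trans UST (subsetIl _ _).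
apply: etrans (esym (prod_interval_sign (x0 _ _ SM US) UST)) _.
apply: eq_bigl => C.
rewrite SM /= andbC; case: (boolP (U \subset C)) => /= _.
  rewrite subsetI; have [CS|] := boolP (C \subset S); rewrite ?andbF //= !andbT.
  by rewrite (cliques_sub (max_cliquesW SM) CS).
by rewrite !andbF.
Qed.

Lemma ker_phi_psi (K : fieldType) (L : {set {set 'I_m}}) (f : {mpoly K[#|L|]}) :
  lattice_graphical_ideal G f <-> psi_hom G f = 0.
Proof. by split; [apply: ker_phi_sub_psi | apply: ker_psi_sub_phi]. Qed.

End Kernels.
End Facts.

(* Main.v *)
(* The kernel of psi is easier than that of phi, because psi maps monomials to
   monomials.  Hibi relations lie in it because a clique of the minimal graph
   contained in the union of two order ideals is contained in one of them.
   Conversely, modulo the Hibi ideal the product of p_T over a list s of order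
   ideals equals the product of p_U over the chain of the sets
   U_j = {i | more than j members of s contain i}, 0 <= j < size s.  This chain
   can be read off the image monomial: size s is the exponent of c_set0 and the
   number of members containing i is the exponent of c_{i}.  Hence monomials
   with the same image are congruent, and if psi f = 0 the coefficients of f
   cancel within each class of such monomials. *)
Require Import Defs.
From mathcomp Require Import all_boot all_order all_algebra.
From mathcomp.multinomials Require Import mpoly.
From mathcomp Require Import zify ring.

Set Implicit Arguments.
Unset Strict Implicit.
Unset Printing Implicit Defensive.

Import GRing.Theory.
Local Open Scope ring_scope.

(** * Closure properties of generated ideals *)

Section GeneratedIdeal.
Context (R : comNzRingType) (B : R -> Prop).

Lemma generated_ideal0 : generated_ideal B 0.
Proof. by exists [::]; rewrite big_nil. Qed.

Lemma generated_idealD f g :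
  generated_ideal B f -> generated_ideal B g -> generated_ideal B (f + g).
Proof.
move=> [s [sB ->]] [t [tB ->]]; exists (s ++ t); rewrite big_cat; split=> // x.
by rewrite mem_cat => /orP[/sB|/tB].
Qed.

Lemma generated_idealMl f g : generated_ideal B g -> generated_ideal B (f * g).
Proof.
move=> [s [sB ->]]; exists [seq (f * x.1, x.2) | x <- s]; split.
  by move=> x /mapP[y /sB yB ->].
by rewrite big_map mulr_sumr; apply: eq_bigr => x _; rewrite mulrA.
Qed.

Lemma generated_ideal_gen g : B g -> generated_ideal B g.
Proof.
move=> Bg; exists [:: (1, g)]; rewrite big_seq1 mul1r; split=> // x.
by rewrite inE => /eqP->.
Qed.

Lemma generated_ideal_sum (I : Type) (r : seq I) (F : I -> R) :
  (forall i, generated_ideal B (F i)) -> generated_ideal B (\sum_(i <- r) F i).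
Proof.
by move=> BF; elim/big_ind: _ => //; [exact: generated_ideal0 | exact: generated_idealD].
Qed.

End GeneratedIdeal.

(** * Straightening products into chains modulo the Hibi ideal *)

Section Straightening.
Context (m : nat).
Implicit Types (L : {set {set 'I_m}}) (S T U : {set 'I_m}) (s : seq {set 'I_m}).

(* When [s] is a decreasing chain, [T] is inserted by repeatedly replacing the
   pair carried set, next element by their union and intersection. *)
Fixpoint insert T s : seq {set 'I_m} :=
  if s is U :: s' then (T :|: U) :: insert (T :&: U) s' else [:: T].

Definition straighten s : seq {set 'I_m} := foldr insert [::] s.

Definition multiplicity s (i : 'I_m) : nat := count (fun T => i \in T) s.

Definition levels (k : 'I_m -> nat) (a n : nat) : seq {set 'I_m} :=
  [seq [set i | j < k i]%N | j <- iota a n].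

Lemma eq_levels (k l : 'I_m -> nat) a n :
  (forall i j, a <= j -> (j < k i) = (j < l i))%N -> levels k a n = levels l a n.
Proof.
move=> kl; apply/eq_in_map => j; rewrite mem_iota => /andP[aj _].
by apply/setP => i; rewrite !inE kl.
Qed.

(** The hypotheses say that [T] lies in every level before [a] and that the levels from [a + n] on
    are empty. The first one passes to the tail of the chain, because the carried set is then [T]
    cut down to level [a]; the offset [a] is there for this induction. *)
Lemma insert_levels T (k : 'I_m -> nat) a n :
  (forall i, i \in T -> a <= k i)%N -> (forall i, k i <= a + n)%N ->
  insert T (levels k a n) = levels (fun i => k i + (i \in T))%N a n.+1.
Proof.
elim: n T a => [|n IHn] T a kT kn.
  congr [:: _]; apply/setP => i; rewrite inE.
  have := kT i; have := kn i; case: (i \in T) => /=; [move=> _ /(_ isT)|]; lia.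
rewrite /levels [iota a _.+2]/= [iota a _.+1]/= !map_cons [insert _ _]/=.
congr (_ :: _).
  apply/setP => i; rewrite !inE; have := kT i.
  case: (i \in T) => /=; [move=> /(_ isT)|]; lia.
rewrite -/(levels k _ _) IHn.
- apply: eq_levels => i j aj; rewrite !inE.
  case: (i \in T) => //=; lia.
- by move=> i; rewrite !inE => /andP[].
- by move=> i; have := kn i; lia.
Qed.

Lemma straighten_levels s : straighten s = levels (multiplicity s) 0 (size s).
Proof.
elim: s => //= T s IHs; rewrite -/(straighten s) IHs insert_levels //.
  by apply: eq_levels => i j _; rewrite addnC.
by move=> i; apply: count_size.
Qed.

Context (K : fieldType) (L : {set {set 'I_m}}) (latL : distributive_lattice L).
Local Notation p := (unknown K L).

Lemma insert_closed T s :
  T \in L -> {subset s <= L} -> {subset insert T s <= L}.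
Proof.
elim: s T => [|U s IHs] T TL sL V /=; first by rewrite inE => /eqP->.
have UL : U \in L by apply: sL; rewrite mem_head.
have [TUL TUL'] := latL TL UL; rewrite inE => /orP[/eqP-> //|].
by apply: IHs TUL _ V => V Vs; apply: sL; rewrite inE Vs orbT.
Qed.

Lemma hibi_insert T s : T \in L -> {subset s <= L} ->
  hibi_ideal (p T * \prod_(U <- s) p U - \prod_(U <- insert T s) p U).
Proof.
elim: s T => [|U s IHs] T TL sL /=.
  by rewrite big_nil big_seq1 mulr1 subrr; apply: generated_ideal0.
have UL : U \in L by apply: sL; rewrite mem_head.
have {}sL : {subset s <= L} by move=> V Vs; apply: sL; rewrite inE Vs orbT.
have [TUL _] := latL TL UL.
rewrite !big_cons; set P := \prod_(V <- s) _; set Q := \prod_(V <- insert _ _) _.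
(* One Hibi relation exchanges the first pair; the rest inserts [T :&: U] into the tail. *)
rewrite (_ : _ - _ = P * (p T * p U - p (T :&: U) * p (T :|: U))
  + p (T :|: U) * (p (T :&: U) * P - Q)); last by ring.
apply: generated_idealD; apply: generated_idealMl; last exact: IHs.
by apply: generated_ideal_gen; exists T, U.
Qed.

Lemma hibi_straighten s : {subset s <= L} ->
  hibi_ideal (\prod_(U <- s) p U - \prod_(U <- straighten s) p U).
Proof.
(* [hibi_insert] is applied to the straightened tail, so the induction must also carry its
   membership in [L]. *)
suff H : {subset s <= L} -> {subset straighten s <= L} /\
    hibi_ideal (\prod_(U <- s) p U - \prod_(U <- straighten s) p U).
  by case/H.
elim: s => [|T s IHs] sL /=.
  by split=> //; rewrite big_nil subrr; apply: generated_ideal0.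
have TL : T \in L by apply: sL; rewrite mem_head.
have [|s'L IH] := IHs; first by move=> V Vs; apply: sL; rewrite inE Vs orbT.
rewrite -/(straighten s) in s'L *; split; first exact: insert_closed.
rewrite big_cons; set P := \prod_(V <- s) _ in IH *.
set Q := \prod_(V <- straighten s) _ in IH.
rewrite -(subrKA (p T * Q)) -mulrBr; apply: generated_idealD.
  exact: generated_idealMl.
exact: hibi_insert.
Qed.

End Straightening.

(** * Exponents of the images of monomials under psi, and the kernel of psi *)

Section CliqueExponents.
Context (K : fieldType) (m : nat) (G : rel 'I_m) (L : {set {set 'I_m}}).
Local Notation N := #|cliques G|.
Local Notation psi := (@psi_hom K m L G).

Definition clique_mnm (T : {set 'I_m}) : 'X_{1..N} :=
  [multinom (enum_val j \subset T : nat) | j < N].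

Definition psi_mnm (a : 'X_{1..#|L|}) : 'X_{1..N} :=
  (\sum_(i < #|L|) clique_mnm (enum_val i) *+ a i)%MM.

Lemma prod_cliques_mpolyX (T : {set 'I_m}) :
  \prod_(S in cliques G | S \subset T) unknown K (cliques G) S
  = 'X_[clique_mnm T].
Proof.
rewrite mpolyXE_id big_mkcondr big_enum_val /=.
apply: eq_bigr => j _; rewrite unknownE mnmE.
by case: (_ \subset _); rewrite ?expr1 ?expr0.
Qed.

Lemma psi_mpolyX (a : 'X_{1..#|L|}) : psi 'X_[a] = 'X_[psi_mnm a].
Proof.
rewrite /psi_hom /alg_hom mmapX /mmap1 /psi_mnm.
rewrite (big_morph (fun w => 'X_[w]) (@mpolyXD _ K) (@mpolyX0 _ K)).
by apply: eq_bigr => i _; rewrite prod_cliques_mpolyX mpolyXn.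
Qed.

Lemma psiE (f : {mpoly K[#|L|]}) :
  psi f = \sum_(a <- msupp f) f@_a *: 'X_[psi_mnm a].
Proof.
rewrite /psi_hom /alg_hom {1}/mmap; apply: eq_bigr => a _.
by rewrite -mul_mpolyC -psi_mpolyX /psi_hom /alg_hom mmapX.
Qed.

(** A sum with at most one term: it needs no proof that [C] is a clique, and is 0 if [C] is not
    one. *)
Definition mnm_at (w : 'X_{1..N}) (C : {set 'I_m}) : nat :=
  \sum_(j < N | enum_val j == C) w j.

Lemma mnm_at_psi (a : 'X_{1..#|L|}) (C : {set 'I_m}) : C \in cliques G ->
  mnm_at (psi_mnm a) C = (\sum_(i < #|L|) (C \subset enum_val i) * a i)%N.
Proof.
move=> CG; rewrite /mnm_at (big_pred1 (enum_rank_in CG C)); last first.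
  by move=> j; rewrite -[C in LHS](enum_rankK_in CG CG) (inj_eq enum_val_inj).
rewrite mnm_sumE; apply: eq_bigr => i _.
by rewrite mulmnE mnmE enum_rankK_in.
Qed.

Definition mnm_sets (a : 'X_{1..#|L|}) : seq {set 'I_m} :=
  flatten [seq nseq (a i) (enum_val i) | i <- enum 'I_#|L|].

Lemma mnm_sets_sub a : {subset mnm_sets a <= L}.
Proof.
by move=> T /flattenP[_ /mapP[i _ ->] /nseqP[-> _]]; apply: enum_valP.
Qed.

Lemma prod_mnm_sets a : \prod_(T <- mnm_sets a) unknown K L T = 'X_[a].
Proof.
rewrite big_flatten big_map big_enum mpolyXE_id; apply: eq_bigr => i _ /=.
by rewrite big_nseq -Monoid.iteropE unknownE.
Qed.

Lemma count_mnm_sets a (P : pred {set 'I_m}) :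
  count P (mnm_sets a) = (\sum_(i < #|L|) P (enum_val i) * a i)%N.
Proof.
rewrite count_flatten sumnE 2!big_map big_enum; apply: eq_bigr => i _ /=.
by rewrite count_nseq.
Qed.

Lemma set0_clique : set0 \in cliques G.
Proof. by rewrite inE; apply/forall_inP => i; rewrite inE. Qed.

Lemma set1_clique i : [set i] \in cliques G.
Proof.
rewrite inE; apply/forall_inP => j /set1P->; apply/forall_inP => k /set1P->.
by rewrite eqxx.
Qed.

Definition psi_levels (w : 'X_{1..N}) : seq {set 'I_m} :=
  levels (fun i => mnm_at w [set i]) 0 (mnm_at w set0).

Lemma straighten_mnm_sets a :
  straighten (mnm_sets a) = psi_levels (psi_mnm a).
Proof.
rewrite straighten_levels /psi_levels -count_predT count_mnm_sets.
rewrite (mnm_at_psi _ set0_clique).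
rewrite (eq_bigr (fun i : 'I_#|L| => (set0 \subset enum_val i) * a i))%N.
  apply: eq_levels => i j _; rewrite /multiplicity count_mnm_sets.
  rewrite (mnm_at_psi _ (set1_clique i)).
  by under [in RHS]eq_bigr => l _ do rewrite sub1set.
by move=> i _; rewrite sub0set.
Qed.

(** Grouped by the value [u] of [w], the scalars [c a] add up to the coefficient of ['X_[u]] in the
    zero polynomial. *)
Lemma sum_scale_mpolyX_eq0 (V : lmodType K) (I : eqType) (r : seq I) (n : nat)
    (c : I -> K) (w : I -> 'X_{1..n}) (F : 'X_{1..n} -> V) :
  \sum_(a <- r) c a *: 'X_[w a] = 0 :> {mpoly K[n]} ->
  \sum_(a <- r) c a *: F (w a) = 0.
Proof.
move=> cw0; pose W := undup [seq w a | a <- r].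
transitivity (\sum_(u <- W)
  (\sum_(a <- r) c a *: 'X_[w a] : {mpoly K[n]})@_u *: F u).
  under [RHS]eq_bigr => u _ do rewrite raddf_sum scaler_suml /=.
  rewrite exchange_big /=; apply: eq_big_seq => a ra.
  have Wa : w a \in W by rewrite mem_undup map_f.
  rewrite (bigD1_seq (w a)) ?undup_uniq //= mcoeffZ mcoeffX eqxx mulr1.
  rewrite big1 ?addr0 //.
  by move=> u ua; rewrite mcoeffZ mcoeffX eq_sym (negbTE ua) mulr0 scale0r.
by rewrite big1 // => u _; rewrite cw0 mcoeff0 scale0r.
Qed.

Lemma psi_ker_hibi (latL : distributive_lattice L) (f : {mpoly K[#|L|]}) :
  psi f = 0 -> hibi_ideal f.
Proof.
rewrite psiE => /(sum_scale_mpolyX_eq0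
  (fun w => \prod_(U <- psi_levels w) unknown K L U)) nf0.
(* Subtracting this zero sum pairs each monomial of [f] with its straightened form. *)
rewrite -[f]subr0 -{}nf0 {1}[f]mpolyE -sumrB; apply: generated_ideal_sum => a.
rewrite -scalerBr -mul_mpolyC; apply: generated_idealMl.
rewrite -prod_mnm_sets -straighten_mnm_sets.
by apply: hibi_straighten => //; apply: mnm_sets_sub.
Qed.

End CliqueExponents.

(* Only the comparability of adjacent vertices is used: a point of [C :\: S] and
   one of [C :\: T] would be adjacent, and the smaller one in both ideals. *)
Lemma clique_sub_setU m (le : rel 'I_m) (C S T : {set 'I_m}) :
  C \in cliques (minimal_graph le) ->
  S \in order_ideals le -> T \in order_ideals le ->
  (C \subset S :|: T) = (C \subset S) || (C \subset T).
Proof.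
rewrite inE => /forall_inP CG /order_idealP hS /order_idealP hT.
apply/idP/orP => [CST|[]/subset_trans]; last 2 first.
- by apply; apply: subsetUl.
- by apply; apply: subsetUr.
have [|/subsetPn[x xC xS]] := boolP (C \subset S); first by left.
right; apply/subsetP => y yC; apply/negPn/negP => yT.
have := subsetP CST y yC; rewrite inE (negbTE yT) orbF => yS.
have := subsetP CST x xC; rewrite inE (negbTE xS) => xT.
have xy : x != y by apply/eqP => xy; rewrite xy yS in xS.
have /forall_inP/(_ y yC)/implyP/(_ xy) := CG x xC.
case/orP => /and3P[_ le_xy _].
  by rewrite (hS _ _ yS le_xy) in xS.
by rewrite (hT _ _ xT le_xy) in yT.
Qed.

Lemma psi_hibi_relation (K : fieldType) m (le : rel 'I_m)
    (g : {mpoly K[#|order_ideals le|]}) :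
  hibi_relation g -> psi_hom (minimal_graph le) g = 0.
Proof.
move=> [S [T [SL TL ->]]]; have [STI STU] := order_ideals_lattice SL TL.
have psiM : {morph @psi_hom K m (order_ideals le) (minimal_graph le) :
  f h / f * h} by move=> f h; rewrite /psi_hom /alg_hom rmorphM.
have psiB : {morph @psi_hom K m (order_ideals le) (minimal_graph le) :
  f h / f - h} by move=> f h; rewrite /psi_hom /alg_hom rmorphB.
rewrite psiB !psiM !psi_unknown // !prod_cliques_mpolyX -!mpolyXD.
apply/eqP; rewrite subr_eq0; apply/eqP; congr 'X_[_]; apply/mnmP => j.
(* At each clique the exponents agree because b + c = (b && c) + (b || c) for booleans. *)
rewrite !mnmDE !mnmE subsetI (clique_sub_setU (enum_valP j) SL TL).
by do 2!case: (_ \subset _).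
Qed.

Theorem theorem7p5 (K : fieldType) (m : nat) (le : rel 'I_m)
    (L : {set {set 'I_m}}) :
  partial_order le -> L = order_ideals le -> natural_lattice L ->
  forall f : {mpoly K[#|L|]},
    lattice_graphical_ideal (minimal_graph le) f <-> hibi_ideal f.
Proof.
move=> _ -> [latL _ _ _] f; rewrite ker_phi_psi; split; first exact: psi_ker_hibi.
move=> [s [sB ->]]; rewrite /psi_hom /alg_hom rmorph_sum big_seq big1 // => x.
by move=> /sB/psi_hibi_relation psix0; rewrite rmorphM [X in _ * X]psix0 mulr0.
Qed.
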